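(* Let $G$ be a finite nonabelian group of odd order with exactly two nonlinear irreducible characters of each degree. Then: (i) if $G$ is an extraspecial $3$-group of order $3^{2r+1}$ for some integer $r\geq 1$, then $\delta(G)=3^{r}$; (ii) if $G$ is a Frobenius group of odd order $\frac{(p^{n}-1)p^{n}}{2}$, for some odd prime $p$ and some integer $n$, with cyclic Frobenius kernel $K$ of order $p^{n}$ and cyclic Frobenius complement, then $\delta(G)=\frac{p^{n}-1}{2}$; in case $K$ is instead abelian but noncyclic (of order $p^n$, with $G$ otherwise as in this item), $\delta(G)$ is at most $\frac{p^{n}-1}{2}\operatorname{rank}(K)$.
   Context: Representations and characters are over $\mathbb{C}$. $\delta(G)$ is the minimal degree of a faithful complex representation of the finite group $G$. A character is nonlinear if its degree is greater than $1$. ''Exactly two nonlinear irreducible characters of each degree'' means that for every integer $d>1$ that occurs as the degree of an irreducible character of $G$, there are exactly two irreducible characters of $G$ of degree $d$. A $p$-group $E$ is extraspecial if $\mathcal{Z}(E)=E'$ is the Frattini subgroup of $E$ and has order $p$. For a finite abelian group $K$, $\operatorname{rank}(K)$ is its minimal number of generators. *)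

(* Defs.v *)
From mathcomp Require Import all_boot all_order all_algebra all_fingroup.
From mathcomp Require Import all_solvable all_field all_character.
From mathcomp Require Import boolp.

Set Implicit Arguments.
Unset Strict Implicit.
Unset Printing Implicit Defensive.

Import GroupScope GRing.Theory.

(* Complex representations and characters are taken over algC, the coefficient
   field of the library's character theory: every complex representation of a
   finite group is equivalent to one over algC, with the same character. *)

Definition has_faithful_repr (gT : finGroupType) (G : {group gT}) (n : nat) :=
  exists rG : mx_representation algC G n, mx_faithful rG.

Lemma ex_faithful_repr (gT : finGroupType) (G : {group gT}) :
  exists n, `[< has_faithful_repr G n >].
Proof.
exists (gcard G); apply/asboolP.
by exists (regular_repr algC G); apply: regular_mx_faithful.
Qed.

Definition delta (gT : finGroupType) (G : {group gT}) : nat :=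
  ex_minn (ex_faithful_repr G).

Definition two_nonlinear_irr_each_degree
    (gT : finGroupType) (G : {group gT}) : Prop :=
  forall d : nat, 1 < d ->
    (exists i : Iirr G, ('chi_i 1%g = d%:R)%R) ->
    #|[set i : Iirr G | ('chi_i 1%g == d%:R)%R]| = 2.

(* Main.v *)
Require Import Defs.
From mathcomp Require Import all_boot all_order all_algebra all_fingroup.
From mathcomp Require Import all_solvable all_field all_character.
From mathcomp Require Import boolp.

Import GroupScope.
Import Order.TTheory GRing.Theory Num.Theory.

(** The minimal degree delta G is the least degree of a faithful character, so
    each value below comes from one faithful character and one lower bound.

    Lower bounds all have the same source ([delta_ge]).  If N is a nontrivial
    subgroup of G, the restriction to N of a faithful character is nontrivial,
    so some irreducible constituent does not have N in its kernel; if every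
    such irreducible character has degree at least d, then so does every
    faithful character.

    Upper bounds come from two constructions.  Inducing a faithful character
    from a nontrivial subgroup H keeps it faithful, whence
    delta G <= |G : H| * delta H ([delta_Ind]).  Inflating faithful characters
    from the two factors of a direct product and adding them gives
    delta (A x B) <= delta A + delta B ([delta_dprod]); decomposing an abelian
    group into 'm(K) cyclic factors then gives delta K <= 'm(K)
    ([delta_abelian]).

    For an extraspecial p-group, take N to be the centre Z, which has prime
    order.  A normal subgroup of a p-group avoiding Z is trivial, so the
    irreducible characters that are nontrivial on Z are exactly the faithful
    ones; since G / Z is abelian, each has degree the square root of |G : Z|
    ([extraspecial_irr1]).

    For a Frobenius group, take N to be the kernel K.  The irreducible
    characters that are nontrivial on K are induced from K, so their degree is
    a multiple of |G : K|, which is the lower bound.  When K is cyclic it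
    matches the upper bound |G : K| * delta K with delta K <= 1. *)

(** * Minimal faithful degree and characters *)

Section Delta.

Set Implicit Arguments.
Unset Strict Implicit.

Implicit Types gT : finGroupType.

Lemma delta_le_char gT (G : {group gT}) (chi : 'CF(G)) n :
  chi \is a character -> cfaithful chi -> (chi 1%g = n%:R)%R -> delta G <= n.
Proof.
case/char_reprP=> -[m rG] -> ffulG /eqP; rewrite cfRepr1 eqr_nat => /eqP <-.
rewrite /delta; case: ex_minnP => k _; apply; apply/asboolP.
by exists rG; move: ffulG; rewrite cfaithfulE cfker_repr.
Qed.

Lemma delta_char gT (G : {group gT}) :
  exists chi : 'CF(G),
    [/\ chi \is a character, cfaithful chi & (chi 1%g = (delta G)%:R)%R].
Proof.
rewrite /delta; case: ex_minnP => n /asboolP[rG ffulG] _.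
exists (cfRepr rG); split; first by rewrite cfRepr_char.
  by rewrite cfaithfulE cfker_repr.
exact: cfRepr1.
Qed.

(** By [cfkerE] the kernel of a character is the intersection of the kernels
    of its constituents, so if all of them contained N, then so would the
    kernel of a faithful character. *)
Lemma delta_ge gT (G N : {group gT}) (d : nat) :
    N \subset G -> N :!=: 1 ->
    (forall i : Iirr G, ~~ (N \subset cfker 'chi_i) -> d%:R <= 'chi_i 1%g)%R ->
  d <= delta G.
Proof.
move=> sNG ntN ge_d; have [chi [Nchi ffchi chi1]] := delta_char G.
rewrite -(ler_nat algC) -chi1.
have /exists_inP[i Ci nkN]:
  [exists i in irr_constt chi, ~~ (N \subset cfker ('chi_i)%R)].
- apply: contraR ntN; rewrite negb_exists_in => /forall_inP kerN.
  rewrite -subG1; apply: subset_trans ffchi; rewrite cfkerE // subsetI sNG.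
  by apply/bigcapsP=> i /kerN; rewrite negbK.
exact: le_trans (ge_d i nkN) (char1_ge_constt Nchi Ci).
Qed.

(** * Upper bounds by induction and by direct products *)

Lemma delta_Ind gT (G H : {group gT}) :
  H \subset G -> H :!=: 1 -> delta G <= #|G : H| * delta H.
Proof.
move=> sHG ntH; have [chi [Nchi ffchi chi1]] := delta_char H.
have nzchi: chi != 0%R.
  apply: contraNneq ntH => chi0; rewrite -subG1; apply: subset_trans ffchi.
  by apply/subsetP=> x Hx; rewrite cfkerEchar // inE Hx chi0 !cfunE eqxx.
apply: (delta_le_char (chi := ('Ind[G] chi)%R)); first exact: cfInd_char.
  by rewrite cfaithfulE cfker_Ind // (subset_trans (gcore_sub _ _)).
by rewrite cfInd1 // chi1 natrM.
Qed.

(** Multiplicities are nonnegative, hence cannot cancel: every constituent of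
    [phi] is a constituent of the sum. *)
Lemma cfker_add_charl gT (G : {group gT}) (phi psi : 'CF(G)) :
    phi \is a character -> psi \is a character ->
  cfker (phi + psi)%R \subset cfker phi.
Proof.
move=> Nphi Npsi; rewrite (cfkerE (chi := phi)) // subsetI cfker_sub.
apply/bigcapsP=> i Ci; apply: cfker_constt; first exact: rpredD.
move: Ci; rewrite !irr_consttE cfdotDl; apply: contraNN.
by rewrite paddr_eq0 ?natr_ge0 ?Cnat_cfdot_char_irr // => /andP[].
Qed.

Lemma delta_dprod gT (G A B : {group gT}) :
  A \x B = G -> delta G <= delta A + delta B.
Proof.
move=> defG; have [phi [Nphi ffphi phi1]] := delta_char A.
have [psi [Npsi ffpsi psi1]] := delta_char B.
have NA: cfDprodl defG phi \is a character by rewrite cfDprodl_char.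
have NB: cfDprodr defG psi \is a character by rewrite cfDprodr_char.
apply: (delta_le_char (chi := (cfDprodl defG phi + cfDprodr defG psi)%R)).
- exact: rpredD.
- apply/subsetP=> x kx.
  have:= subsetP (cfker_add_charl NB NA) x; rewrite addrC => /(_ kx).
  have:= subsetP (cfker_add_charl NA NB) x kx.
  rewrite !cfkerEchar // !inE => /andP[Gx].
  have [a [b [Aa Bb -> _]]] := mem_dprod defG Gx.
  rewrite (cfDprodEl defG phi Aa Bb) (cfDprodEr defG psi Aa Bb).
  rewrite (cfDprodl1 defG phi) (cfDprodr1 defG psi) => phi_a /andP[_ psi_b].
  have: a \in [1] by apply: (subsetP ffphi); rewrite cfkerEchar // inE Aa.
  have: b \in [1] by apply: (subsetP ffpsi); rewrite cfkerEchar // inE Bb.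
  by rewrite !inE => /eqP-> /eqP->; rewrite mulg1.
- by rewrite cfunE (cfDprodl1 defG phi) (cfDprodr1 defG psi) phi1 psi1 natrD.
Qed.

(** The zero-dimensional representation of the trivial group is faithful. *)
Lemma delta_1 gT (G : {group gT}) : G :=: 1 -> delta G = 0.
Proof.
move=> G1; apply/eqP; rewrite -leqn0; apply: (delta_le_char (chi := 0%R)).
- exact: rpred0.
- by rewrite cfaithfulE -G1 cfker_sub.
- by rewrite cfunE.
Qed.

(** A linear character of <[x]> is determined by its value at [x], which is a
    root of unity of order dividing n = #[x].  The n characters therefore take
    all n-th roots of unity as values at [x]; one taking a primitive root is
    faithful. *)
Lemma delta_cyclic gT (G : {group gT}) : cyclic G -> delta G <= 1.
Proof.
move=> cycG; have linG (i : Iirr G) := irr_cyclic_lin i cycG.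
have oI := card_Iirr_cyclic cycG.
have /cyclicP[x defG] := cycG; have Gx: x \in G by rewrite defG cycle_id.
have oG: #|G| = #[x] by rewrite defG.
have val_inj: injective (fun i : Iirr G => 'chi_i x)%R.
  move=> i j /= eq_x; apply: irr_inj; apply/cfun_inP=> y Gy.
  have /cycleP[k ->]: y \in <[x]> by rewrite -defG.
  by rewrite !lin_charX // eq_x.
have [z prim_z] := C_prim_root_exists (order_gt0 x).
have [i z_i]: exists i : Iirr G, ('chi_i x = z)%R.
  have /codomP[i ->]: z \in codom (fun i : Iirr G => 'chi_i x)%R.
    rewrite -(mem_unity_roots (order_gt0 x)).
    - by apply/unity_rootP; apply: prim_expr_order.
    - apply/allP=> _ /codomP[i ->]; apply/unity_rootP.
      by rewrite -lin_charX // expg_order lin_char1.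
    - by rewrite map_inj_uniq ?enum_uniq.
    - by rewrite size_codom oI oG.
  by exists i.
apply: (delta_le_char (irr_char i)); last by rewrite lin_char1.
apply/subsetP=> y; rewrite cfkerEirr !inE lin_char1 // => /eqP chi_y.
have Gy: y \in G.
  by apply: contraT => /cfun0 y0; move/eqP: chi_y; rewrite y0 eq_sym oner_eq0.
have /cycleP[k def_y]: y \in <[x]> by rewrite -defG.
move: chi_y; rewrite def_y lin_charX // z_i => /eqP.
by rewrite -(prim_order_dvd prim_z) order_dvdn.
Qed.

(** An abelian group has a decomposition into 'm(K) cyclic factors, the
    smallest possible number. *)
Lemma delta_abelian gT (K : {group gT}) : abelian K -> delta K <= 'm(K).
Proof.
move=> abK; have [b defK szb] := abelian_structure abK.
rewrite grank_abelian // -size_abelian_type // -szb size_map.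
elim: b K defK {abK szb} => [|x b IHb] K; rewrite (big_nil, big_cons).
  by move=> /esym/delta_1->.
move=> defK; have [[_ B _ defB] _ _ _] := dprodP defK.
rewrite defB in defK; apply: leq_trans (delta_dprod defK) _.
exact: leq_add (delta_cyclic (cycle_cyclic x)) (IHb _ defB).
Qed.

(** * Extraspecial groups *)

(** The kernel of ['chi_i] meets the centre trivially, because the centre has
    prime order; nilpotence then makes ['chi_i] faithful, so that its own centre
    is that of G.  The quotient by it is abelian, which forces equality in the
    general bound of the squared degree by the index of that centre. *)
Lemma extraspecial_irr1 gT (G : {group gT}) (p : nat) (i : Iirr G) :
    p.-group G -> extraspecial G -> ~~ ('Z(G) \subset cfker ('chi_i)%R) ->
  ('chi_i 1%g ^+ 2 = #|G : 'Z(G)|%:R)%R.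
Proof.
move=> pG [[_ derG] prZ] nkZ.
have fful_i: cfaithful ('chi_i)%R.
  rewrite cfaithfulE subG1; apply/eqP.
  apply: (TI_center_nil (pgroup_nil pG) (cfker_normal ('chi_i)%R)).
  by rewrite setIC prime_TIg.
have ZiZ := cfcenter_fful_irr fful_i.
by rewrite -ZiZ irr1_abelian_bound // ZiZ sub_der1_abelian // derG.
Qed.

Lemma delta_extraspecial gT (G : {group gT}) (p r : nat) :
    p.-group G -> extraspecial G -> #|G| = (p ^ (2 * r + 1))%N ->
  delta G = (p ^ r)%N.
Proof.
move=> pG esG oG; have [_ prZ] := esG.
have oZ: #|'Z(G)| = p by apply: card_center_extraspecial esG.
have p_pr: prime p by rewrite -oZ.
have deg_i (i : Iirr G): ~~ ('Z(G) \subset cfker ('chi_i)%R) ->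
  ('chi_i 1%g = (p ^ r)%:R)%R.
- move=> nkZ; apply/eqP; rewrite -(eqrXn2 (n := 2)) ?ler0n ?ltW ?irr1_gt0 //.
  rewrite (extraspecial_irr1 pG esG nkZ) -natrX -divgS ?center_sub //.
  by rewrite oG oZ expnD expn1 mulnK ?prime_gt0 // -expnM mulnC.
have ntZ: 'Z(G) :!=: 1 by rewrite -cardG_gt1 oZ prime_gt1.
apply/eqP; rewrite eqn_leq; apply/andP; split; last first.
  apply: (delta_ge (center_sub G) ntZ) => i /deg_i->; exact: lexx.
have [i ffi] := pgroup_cyclic_faithful pG (prime_cyclic prZ).
apply: (delta_le_char (irr_char i) ffi); apply: deg_i.
by apply: contra ntZ => kZ; rewrite -subG1 (subset_trans kZ).
Qed.

(** * Frobenius groups *)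

(** The irreducible characters that are nontrivial on the kernel are induced
    from it, so their degrees are multiples of its index. *)
Lemma delta_Frobenius_ge gT (G K : {group gT}) :
  [Frobenius G with kernel K] -> #|G : K| <= delta G.
Proof.
move=> frobG; have [ntK _ nsKG _] := Frobenius_kerP frobG.
have sKG := normal_sub nsKG.
apply: (delta_ge sKG ntK) => i /(Frobenius_Ind_irrP frobG)[j _ ->].
rewrite cfInd1 // ler_peMr ?ler0n //.
by have:= irr1_gt0 j; have /natrP[m ->] := Cnat_irr1 j; rewrite ltr0n ler1n.
Qed.

End Delta.

(* In part (ii), 'm(K) is the minimal number of generators of K; the divisions
   by 2 are exact since p is odd. *)
Theorem theorem5p1 (gT : finGroupType) (G : {group gT})
    (oddG : odd #|G|) (nabG : ~~ abelian G)
    (irrG : two_nonlinear_irr_each_degree G) :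
  (forall r : nat, 1 <= r ->
     3.-group G -> extraspecial G -> #|G| = (3 ^ (2 * r + 1))%N ->
     delta G = (3 ^ r)%N)
  /\
  (forall (p n : nat) (K H : {group gT}),
     prime p -> odd p ->
     [Frobenius G = K ><| H] ->
     #|G| = (((p ^ n - 1) * p ^ n) %/ 2)%N ->
     #|K| = (p ^ n)%N ->
     cyclic H ->
     (cyclic K -> delta G = ((p ^ n - 1) %/ 2)%N)
     /\
     (abelian K -> ~~ cyclic K ->
        delta G <= ((p ^ n - 1) %/ 2 * 'm(K))%N)).
Proof.
split=> [r _ pG esG oG | p n K H p_pr odd_p frobG oG oK _].
  exact: (delta_extraspecial pG).
have [defG ntK _ _ _] := Frobenius_context frobG.
have [/andP[sKG _] _ _ _ _] := sdprod_context defG.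
have pn_gt0: 0 < p ^ n by rewrite expn_gt0 prime_gt0.
have iGK: #|G : K| = ((p ^ n - 1) %/ 2)%N.
  rewrite -divgS // oG oK [in X in (X %/ _) %/ _]mulnC -muln_divA ?mulKn //.
  by rewrite dvdn2 oddB // oddX odd_p orbT.
rewrite -iGK; split=> [cycK | abK _]; last first.
  apply: leq_trans (delta_Ind sKG ntK) _.
  by rewrite leq_mul2l delta_abelian ?orbT.
apply/eqP.
rewrite eqn_leq (delta_Frobenius_ge (FrobeniusWker frobG)) andbT.
apply: leq_trans (delta_Ind sKG ntK) _.
by rewrite -[leqRHS]muln1 leq_mul2l delta_cyclic ?orbT.
Qed.
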